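(* Let $d\geq 1$ and let $\epsilon$ be a fixed real number with $0<\epsilon<2-\lambda_d$. Then asymptotically almost surely (as $n\to\infty$) $$\chi\left(\mathrm{Bor}^d_n(\epsilon)\right)=d+2.$$
   Context: $S^d\subset\mathbb{R}^{d+1}$ is the unit sphere and $\|\cdot\|$ is the Euclidean norm of $\mathbb{R}^{d+1}$. The random Borsuk graph $\mathrm{Bor}^d_n(\epsilon)$ has as vertices $n$ independent uniformly distributed random points $X_1,\dots,X_n$ on $S^d$, with $X_i$ and $X_j$ ($i\neq j$) adjacent if and only if $\|X_i-X_j\|>2-\epsilon$. $\chi$ denotes chromatic number. An event holds asymptotically almost surely if its probability tends to $1$ as $n\to\infty$. The constant $\lambda_d$ is defined as follows: let $\Delta$ be a regular $(d+1)$-simplex inscribed in $S^d$, let $\Phi:\partial\Delta\to S^d$, $\Phi(x)=x/\|x\|$, and let $\tau$ be any facet of $\Delta$; then $\lambda_d$ is the (Euclidean) diameter of $\Phi(\tau)$ (this does not depend on the choice of facet). *)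

(* Defs.v *)
From HB Require Import structures.
From mathcomp Require Import all_boot all_order all_algebra.
From mathcomp Require Import all_classical all_reals all_analysis.

Set Implicit Arguments.
Unset Strict Implicit.
Unset Printing Implicit Defensive.

Import Order.TTheory GRing.Theory Num.Theory.
Import numFieldNormedType.Exports.

Local Open Scope classical_set_scope.
Local Open Scope ring_scope.

(* The norm [`|x|] that the library puts on row vectors is the sup norm, hence
   a separate Euclidean norm.  Both induce the topology used for [open]. *)
Definition enorm (R : realType) (m : nat) (x : 'rV[R]_m) : R :=
  Num.sqrt (\sum_(i < m) x ord0 i ^+ 2).

(* Real-valued supremum: meaningful for nonempty bounded [A]. *)
Definition ediam (R : realType) (m : nat) (A : set 'rV[R]_m) : R :=
  sup [set r | exists x y, [/\ A x, A y & r = enorm (x - y)]].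

Definition sphere (R : realType) (d : nat) : set 'rV[R]_d.+1 :=
  [set x | enorm x = 1].

Lemma enormN (R : realType) (m : nat) (x : 'rV[R]_m) : enorm (- x) = enorm x.
Proof.
by rewrite /enorm; congr Num.sqrt; apply: eq_bigr => i _; rewrite mxE sqrrN.
Qed.

(* d+2 equidistant distinct points of R^(d+1) are affinely independent, so they
   are indeed the vertices of a (d+1)-simplex. *)
Definition regular_inscribed_simplex (R : realType) (d : nat)
    (v : 'I_d.+2 -> 'rV[R]_d.+1) : Prop :=
  (forall i, sphere (v i)) /\
  exists2 s : R, 0 < s & forall i j, i != j -> enorm (v i - v j) = s.

(* The facet opposite to the vertex [v k]: the convex hull of the others. *)
Definition facet (R : realType) (d : nat) (v : 'I_d.+2 -> 'rV[R]_d.+1)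
    (k : 'I_d.+2) : set 'rV[R]_d.+1 :=
  [set x | exists w : 'I_d.+2 -> R,
     [/\ forall i, 0 <= w i, w k = 0, \sum_i w i = 1 & x = \sum_i w i *: v i]].

Definition radial_proj (R : realType) (d : nat) (x : 'rV[R]_d.+1) :
    'rV[R]_d.+1 :=
  (enorm x)^-1 *: x.

Definition lambda (R : realType) (d : nat) (v : 'I_d.+2 -> 'rV[R]_d.+1)
    (k : 'I_d.+2) : R :=
  ediam (@radial_proj R d @` facet v k).

Record sgraph (V : finType) := SGraph {
  adj :> rel V;
  adj_sym : symmetric adj;
  adj_irr : irreflexive adj }.

Definition colorable (V : finType) (G : sgraph V) (k : nat) : bool :=
  [exists f : {ffun V -> 'I_k}, [forall x, [forall y, G x y ==> (f x != f y)]]].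

Lemma ex_colorable (V : finType) (G : sgraph V) : exists k, colorable G k.
Proof.
exists #|V|; apply/existsP; exists [ffun x => enum_rank x].
apply/forallP => x; apply/forallP => y; apply/implyP => Gxy.
rewrite !ffunE; apply/eqP => /enum_rank_inj xy.
by rewrite xy adj_irr in Gxy.
Qed.

Definition chromatic_number (V : finType) (G : sgraph V) : nat :=
  ex_minn (ex_colorable G).

Definition borsuk_rel (R : realType) (d n : nat) (eps : R)
    (x : 'I_n -> 'rV[R]_d.+1) : rel 'I_n :=
  fun i j => (i != j) && (2 - eps < enorm (x i - x j)).

Lemma borsuk_sym (R : realType) (d n : nat) (eps : R)
  (x : 'I_n -> 'rV[R]_d.+1) : symmetric (borsuk_rel eps x).
Proof. by move=> i j; rewrite /borsuk_rel eq_sym -enormN opprB. Qed.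

Lemma borsuk_irr (R : realType) (d n : nat) (eps : R)
  (x : 'I_n -> 'rV[R]_d.+1) : irreflexive (borsuk_rel eps x).
Proof. by move=> i; rewrite /borsuk_rel eqxx. Qed.

Definition borsuk_graph (R : realType) (d n : nat) (eps : R)
    (x : 'I_n -> 'rV[R]_d.+1) : sgraph 'I_n :=
  SGraph (borsuk_sym eps x) (borsuk_irr eps x).

(* R^(d+1) with its Borel sigma-algebra. *)
Notation borel_rV R d := (g_sigma_algebraType (@open 'rV[R]_d.+1)).

(* The uniform distribution on the sphere is the unique Borel probability
   measure carried by the sphere that is invariant under O(d+1), i.e. the
   normalized surface measure. *)
Definition uniform_on_sphere (R : realType) (d : nat)
    (mu : set (borel_rV R d) -> \bar R) : Prop :=
  mu (@sphere R d) = 1%E /\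
  forall (U : 'M[R]_d.+1) (A : set (borel_rV R d)),
    U *m U^T = 1%:M -> measurable A -> mu ((fun x => x *m U) @^-1` A) = mu A.

Definition mutually_independent (disp disp' : measure_display)
    (T : measurableType disp) (T' : measurableType disp') (R : realType)
    (P : probability T R) (I : finType) (X : I -> {RV P >-> T'}) : Prop :=
  forall (J : {set I}) (B : I -> set T'), (forall i, measurable (B i)) ->
    P (\bigcap_(i in [set i | i \in J]) (X i @^-1` B i)) =
    (\prod_(i in J) P (X i @^-1` B i))%E.

(* Main.v *)
Require Import Defs.
From HB Require Import structures.
From mathcomp Require Import all_boot all_order all_algebra all_fingroup.
From mathcomp Require Import finmap.
From mathcomp Require Import all_classical all_reals all_analysis.
From mathcomp Require Import measurable_realfun ring lra.

(** Upper bound: the cones over the d+2 facets of the simplex cover the space,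
    and two points of the sphere in the same cone are at distance at most
    lambda < 2 - eps; so the facet index is a proper colouring.

    Lower bound: some finite set F of points of the sphere has, in each of its
    (d+1)-colourings, two points of the same colour at distance greater than
    2 - eps/2.  All caps of a given radius have the same probability, which is
    bounded below because finitely many of them cover the sphere; so with
    probability tending to 1 every point of F is within eps/4 of a sample point,
    and a (d+1)-colouring of the sample would colour F.

    F comes from Ky Fan's proof of the Borsuk-Ulam theorem, carried out on
    mod 2 chains of small ordered simplices of points of the sphere rather than
    on a triangulation.  Chains h_0, ..., h_d with boundary of h_(i+1) equal to
    h_i + (-h_i) are built by pushing the cycle h_i + (-h_i) of the i-sphere
    in small steps towards a pole of the (i+1)-sphere.  For an antipodal
    labelling without complementary edges, the number of simplices of
    h_i + (-h_i) whose labels alternate in sign, starting with +, keeps the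
    parity that it has for i = 0, that is, odd; but d+1 alternating labels
    cannot have only d absolute values. *)

Set Implicit Arguments.
Unset Strict Implicit.
Unset Printing Implicit Defensive.

Import Order.TTheory GRing.Theory Num.Theory.
Import numFieldNormedType.Exports.

(** * Mod 2 chains and Ky Fan's cochain *)

(* A chain is a list of simplices, a simplex a list of vertices; [cobound F] is the
   mod 2 cochain [F] evaluated on the boundary.  Identities between chains are
   stated by evaluating all cochains on them. *)
Fixpoint cobound (T : Type) (F : seq T -> bool) (s : seq T) : bool :=
  if s is x :: s' then F s' (+) cobound (fun t => F (x :: t)) s' else false.

Lemma eq_cobound (T : Type) (F G : seq T -> bool) : F =1 G -> cobound F =1 cobound G.
Proof.
move=> FG s; elim: s F G FG => //= x s IH F G FG.
by rewrite FG (IH _ (fun t => G (x :: t))).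
Qed.

Lemma cobound_map (T U : Type) (f : T -> U) (F : seq U -> bool) s :
  cobound (fun t => F (map f t)) s = cobound F (map f s).
Proof. by elim: s F => //= x s IH F; rewrite (IH (fun t => F (f x :: t))). Qed.

(** [rem x] deletes the first occurrence of [x], which for a symmetric cochain is as good as
    deleting any other. The boundary thus becomes a sum over entries, and such sums are invariant
    under permutation. *)
Lemma cobound_rem (T : eqType) (F : seq T -> bool) s :
  (forall s1 s2, perm_eq s1 s2 -> F s1 = F s2) ->
  cobound F s = \big[addb/false]_(x <- s) F (rem x s).
Proof.
elim: s F => [|x s IH] F symF /=; first by rewrite big_nil.
rewrite big_cons eqxx; congr (_ (+) _).
rewrite IH; last by move=> s1 s2 s12; apply: symF; rewrite perm_cons.
apply: eq_big_seq => y ys; apply: symF.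
have [->|_] := eqVneq x y; last by [].
by rewrite perm_sym perm_to_rem.
Qed.

Lemma perm_rem (T : eqType) (x : T) s1 s2 :
  perm_eq s1 s2 -> perm_eq (rem x s1) (rem x s2).
Proof.
move=> s12; have [xs1|xs1] := boolP (x \in s1); last first.
  by rewrite !rem_id // -(perm_mem s12).
have xs2 : x \in s2 by rewrite -(perm_mem s12).
rewrite -(perm_cons x) -(permPl (perm_to_rem xs1)) (permPl s12).
exact: perm_to_rem.
Qed.

Lemma cobound_perm (T : eqType) (F : seq T -> bool) s1 s2 :
  (forall s1 s2, perm_eq s1 s2 -> F s1 = F s2) ->
  perm_eq s1 s2 -> cobound F s1 = cobound F s2.
Proof.
move=> symF s12; rewrite !cobound_rem // (perm_big _ s12) /=.
by apply: eq_big_seq => x _; apply: symF; apply: perm_rem.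
Qed.

Fixpoint alternates (b : bool) (s : seq bool) : bool :=
  if s is x :: s' then (x == b) && alternates (~~ b) s' else true.

(** If [s] alternates, only the deletion of an end entry leaves a sequence alternating from [b]: the
    last entry if [s] starts with [b], the first otherwise. If [s] does not alternate, a good
    deletion hits one of two equal neighbours, so good deletions come in pairs. *)
Lemma cobound_alternates b s :
  cobound (alternates b) s = alternates b s (+) alternates (~~ b) s.
Proof.
have cob0 t : cobound (xpred0 : seq bool -> bool) t = false by elim: t.
elim: s b => [|x s IH] b //=; rewrite negbK.
have [->|xb] := eqVneq x b.
  rewrite [cobound _ _]IH negbK (_ : (b == ~~ b) = false) ?addbF; last by case: b.
  by case: (alternates b s) (alternates (~~ b) s) => [] [].
by rewrite [cobound _ s]cob0 addbF; case: x b xb => [] [].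
Qed.

(* The label with absolute value [m] and sign [b] is encoded as [b + m.*2].  Sorting
   makes the value independent of the order of the vertices. *)
Definition fan_cochain (b : bool) (l : seq nat) : bool :=
  alternates b (map odd (sort leq l)).

Lemma fan_cochain_perm b s1 s2 :
  perm_eq s1 s2 -> fan_cochain b s1 = fan_cochain b s2.
Proof.
rewrite /fan_cochain => s12; congr (alternates _ (map _ _)).
exact/(perm_sortP leq_total leq_trans anti_leq).
Qed.

Lemma cobound_sorted (F : seq nat -> bool) s :
  sorted leq s -> cobound (fun t => F (sort leq t)) s = cobound F s.
Proof.
(* [cobound] moves the entries already passed into the cochain, hence the prefix. *)
have Hgen pre : forall G, sorted leq (pre ++ s) ->
    cobound (fun t => G (sort leq (pre ++ t))) s = cobound (fun t => G (pre ++ t)) s.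
  elim: s pre => //= x s IH pre G srt.
  have srt' : sorted leq (rcons pre x ++ s) by rewrite cat_rcons.
  rewrite sorted_sort; last 2 first.
  - exact: leq_trans.
  - apply: (subseq_sorted leq_trans _ srt).
    by rewrite subseq_cat2l // subseq_cons.
  have := IH _ G srt'.
  under eq_cobound do rewrite cat_rcons.
  move=> ->.
  by under eq_cobound do rewrite cat_rcons.
exact: (Hgen [::]).
Qed.

(** On a simplex without complementary labels, [fan_cochain_flip] turns the second summand into the
    value at the antipodal simplex; this carries the parity from one dimension to the next. *)
Lemma cobound_fan b l :
  cobound (fan_cochain b) l = fan_cochain b l (+) fan_cochain (~~ b) l.
Proof.
rewrite (@cobound_perm _ _ _ (sort leq l)); last 2 first.
- exact: fan_cochain_perm.
- by rewrite perm_sym perm_sort.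
rewrite (cobound_sorted (fun t => alternates b (map odd t))); last exact: (sort_sorted leq_total).
by rewrite cobound_map cobound_alternates.
Qed.

(** Negation of a label in this encoding: the sign bit changes, the absolute value [k./2] stays. *)
Definition flip (k : nat) : nat := if odd k then k.-1 else k.+1.

Lemma odd_flip k : odd (flip k) = ~~ odd k.
Proof. by rewrite /flip; case: k => //= k; case: ifP => /=; case: odd. Qed.

Lemma flip_half k : (flip k)./2 = k./2.
Proof.
rewrite /flip; case: ifP => ok; last by rewrite -uphalfE uphalf_half ok.
by rewrite -[k in RHS](prednK (odd_gt0 ok)) -uphalfE uphalf_half; case: k ok => //= k /negbTE ->.
Qed.

Lemma half_ltn j k : k != flip j -> j < k -> j./2 < k./2.
Proof.
move=> kj jk; rewrite ltn_neqAle half_leq ?andbT; last exact: ltnW.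
apply: contraNneq kj => jk2; apply/eqP.
have : odd j + j./2.*2 < odd k + k./2.*2 by rewrite !odd_double_half.
rewrite -[k in LHS]odd_double_half -[flip j]odd_double_half.
rewrite flip_half odd_flip jk2 ltn_add2r.
by case: (odd k) (odd j) => [] [].
Qed.

(** Distinct labels that are not complementary differ in absolute value, which decides their order
    and which [flip] preserves. *)
Lemma leq_flip j k : k != flip j -> j <= k -> flip j <= flip k.
Proof.
have E i : i = odd i + i./2.*2 by rewrite odd_double_half.
move=> kj; rewrite leq_eqVlt => /predU1P[->//|/(half_ltn kj) jk2].
rewrite (E (flip j)) (E (flip k)) !flip_half.
apply: (@leq_trans (j./2.+1.*2)); last by rewrite (leq_trans _ (leq_addl _ _)) // leq_double.
by rewrite doubleS -addn2 addnC leq_add2l; case: odd.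
Qed.

(** By [leq_flip], sorting commutes with [flip] on such labels, so only the signs are reversed. *)
Lemma fan_cochain_flip b l :
  (forall j k, j \in l -> k \in l -> k != flip j) ->
  fan_cochain b (map flip l) = fan_cochain (~~ b) l.
Proof.
move=> nocomp; rewrite /fan_cochain.
have -> : sort leq (map flip l) = map flip (sort leq l).
  apply: (sorted_eq leq_trans anti_leq).
  - exact: sort_sorted leq_total _.
  - rewrite sorted_map.
    apply: (@sub_in_sorted _ (mem l) leq); last exact: sort_sorted leq_total _.
      by move=> j k jl kl; apply: leq_flip; apply: nocomp.
    by apply/allP => j; rewrite mem_sort.
  - by rewrite perm_sort perm_sym perm_map // perm_sort.
rewrite -map_comp (eq_map (g := negb \o odd)); last exact: odd_flip.
rewrite map_comp; elim: (map odd _) b => //= x s IH b.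
by rewrite IH; congr (_ && _); case: x b => [] [].
Qed.

Lemma alternates_half b s :
  (forall j k, j \in s -> k \in s -> k != flip j) ->
  sorted leq s -> alternates b (map odd s) -> sorted ltn (map half s).
Proof.
elim: s b => // x [//|y s] IH b nocomp /= /andP[xy srt] /and3P[/eqP xb yb alt].
apply/andP; split; last first.
  apply: (IH (~~ b)) => //=; last by rewrite yb.
  by move=> j k js ks; apply: nocomp; rewrite inE ?js ?ks orbT.
apply: half_ltn; first by apply: nocomp; rewrite !inE eqxx ?orbT.
by rewrite ltn_neqAle xy andbT; apply: contraTneq yb => <-; rewrite xb; case: b {xb alt}.
Qed.

(** Once sorted, alternating labels have strictly increasing absolute values, and only [d] values
    are available. *)
Lemma fan_cochain_size b l d :
  (forall j k, j \in l -> k \in l -> k != flip j) ->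
  (forall j, j \in l -> j < d.*2) -> fan_cochain b l -> size l <= d.
Proof.
move=> nocomp small alt.
have mem_s j : (j \in sort leq l) = (j \in l) by rewrite mem_sort.
have := alternates_half _ (sort_sorted leq_total l) alt.
rewrite -(size_sort leq) -(size_map half) => srt.
have {}srt : uniq (map half (sort leq l)).
  apply: (sorted_uniq ltn_trans ltnn); apply: srt => j k.
  by rewrite !mem_s; apply: nocomp.
rewrite -(size_iota 0 d); apply: uniq_leq_size => // j /mapP[k].
rewrite mem_s => /small kd ->; rewrite mem_iota add0n /=.
by rewrite ltn_half_double.
Qed.

(** * The prism operator *)

Section Prism.
Variables (T : eqType) (f0 f1 : T -> T).
(** The standard triangulation of the prism: its simplices follow [f0] up to some vertex, repeat
    that vertex under [f1], and go on with [f1]. *)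
Fixpoint prism (s : seq T) : seq (seq T) :=
  if s is x :: s' then
    (f0 x :: map f1 s) :: map (cons (f0 x)) (prism s')
  else [::].

Lemma cobound_addb (F G : seq T -> bool) s :
  cobound (fun t => F t (+) G t) s = cobound F s (+) cobound G s.
Proof. by elim: s F G => //= x s IH F G; rewrite IH addbACA. Qed.

(** The chain homotopy formula between [f0] and [f1], in dual form: inner faces of the prism occur
    twice and cancel mod 2. *)
Lemma prism_homotopy (F : seq T -> bool) (s : seq T) :
  \big[addb/false]_(t <- prism s) cobound F t =
  cobound (fun u => \big[addb/false]_(t <- prism u) F t) s
    (+) F (map f0 s) (+) F (map f1 s).
Proof.
elim: s F => [|x s IH] F /=; first by rewrite big_nil addbb.
rewrite big_cons big_map /= big_split /=.
rewrite (IH (fun t => F (f0 x :: t))).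
rewrite -[cobound _ (map f1 s)](cobound_map f1 (fun t => F (f0 x :: f1 x :: t))).
under [in RHS]eq_cobound do rewrite big_cons big_map.
rewrite cobound_addb.
set a := F (f1 x :: _); set b := F (f0 x :: map f1 s); set c := F (f0 x :: map f0 s).
set e := cobound _ s; set g := cobound _ s; set h := \big[_/_]_(_ <- _) _.
by case: a b c e g h => [] [] [] [] [] [].
Qed.

Lemma size_prism s t : t \in prism s -> size t = (size s).+1.
Proof.
elim: s t => //= x s IH t; rewrite inE => /predU1P[->|/mapP[u us ->]] /=.
  by rewrite size_map.
by rewrite (IH u).
Qed.

Lemma mem_prism s t y :
  t \in prism s -> y \in t -> exists2 x, x \in s & y = f0 x \/ y = f1 x.
Proof.
elim: s t => //= x s IH t; rewrite inE => /predU1P[->|/mapP[u us ->]] /=;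
  rewrite !inE => /orP[/eqP->|].
- by exists x; [rewrite mem_head|left].
- case/orP => [/eqP->|/mapP[z zs ->]]; first by exists x; [rewrite mem_head|right].
  by exists z; [rewrite inE zs orbT|right].
- by exists x; [rewrite mem_head|left].
by move=> yu; have [z zs yz] := IH _ us yu; exists z => //; rewrite inE zs orbT.
Qed.
End Prism.

Lemma addb_telescope (g : nat -> bool) M :
  \big[addb/false]_(0 <= t < M) (g t (+) g t.+1) = g 0 (+) g M.
Proof.
elim: M => [|M IH]; first by rewrite big_geq // addbb.
by rewrite big_nat_recr //= IH -addbA addKb.
Qed.

(** * Coning off an antipodal cycle *)

Section Suspension.
Variables (T : eqType) (opp : T -> T) (f : nat -> T -> T) (M : nat) (N : T).
Hypotheses (oppK : involutive opp) (f_start : f 0 =1 id) (f_end : forall x, f M x = N).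

Definition antipodal_cycle (h : seq (seq T)) :=
  forall G : seq T -> bool,
    \big[addb/false]_(s <- h) (cobound G s (+) cobound G (map opp s)) = false.

(** The track of the cycle [h] plus its antipode as [f] moves it, from the identity at time 0 to the
    constant [N] at time [M]. *)
Definition suspension (h : seq (seq T)) : seq (seq T) :=
  flatten [seq flatten [seq prism (f t) (f t.+1) s | s <- h ++ map (map opp) h]
          | t <- index_iota 0 M].

(** In the prism formula summed over all times, the term on the boundary of the cycle vanishes and
    the two ends telescope. *)
Lemma cobound_suspension (F : seq T -> bool) h n :
  {in h, forall s, size s = n} -> antipodal_cycle h ->
  \big[addb/false]_(s <- suspension h) cobound F s =
  \big[addb/false]_(s <- h) (F s (+) F (map opp s)).
Proof.
move=> size_h cyc; set z := h ++ map (map opp) h.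
pose g t := \big[addb/false]_(s <- z) F (map (f t) s).
have step t : \big[addb/false]_(r <- flatten [seq prism (f t) (f t.+1) s | s <- z])
    cobound F r = g t (+) g t.+1.
  rewrite big_flatten big_map.
  under eq_bigr do rewrite prism_homotopy -addbA.
  rewrite big_split /= big_split /= [X in X (+) _](_ : _ = false) //.
  rewrite big_cat /= big_map -big_split; exact: cyc.
rewrite big_flatten big_map (eq_bigr _ (fun t _ => step t)) addb_telescope.
(* [f M] is constant, so a simplex and its antipode have the same image and cancel. *)
have -> : g M = false.
  rewrite /g big_cat /= big_map -big_split big1_seq // => s /= sh.
  suff -> : map (f M) s = map (f M) (map opp s) by rewrite addbb.
  by rewrite -map_comp; apply: eq_map => x /=; rewrite !f_end.
rewrite addbF /g big_cat /= big_map -big_split; apply: eq_bigr => s _.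
by rewrite !(eq_map f_start) !map_id.
Qed.

(** The boundary of the suspension is [h] plus its antipode, which is invariant under [opp]; adding
    its own antipode gives 0 mod 2. *)
Lemma suspension_cycle h n :
  {in h, forall s, size s = n} -> antipodal_cycle h -> antipodal_cycle (suspension h).
Proof.
move=> size_h cyc G; rewrite big_split /=.
under [X in _ (+) X]eq_bigr do rewrite -(cobound_map opp G).
rewrite !(@cobound_suspension _ _ n) // -big_split big1 // => s _ /=.
by rewrite (mapK oppK) addbC addbC (addbC (G _)) addbb.
Qed.

Lemma mem_suspension h s : s \in suspension h ->
  exists t u, [/\ (t < M)%N, u \in h & s \in prism (f t) (f t.+1) u \/
    s \in prism (f t) (f t.+1) (map opp u)].
Proof.
case/flatten_mapP => t; rewrite mem_index_iota => /andP[_ tM].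
case/flatten_mapP => u; rewrite mem_cat => /orP[uh|/mapP[v vh ->]] su.
  by exists t, u; split => //; left.
by exists t, v; split => //; right.
Qed.
End Suspension.

Local Open Scope classical_set_scope.
Local Open Scope ring_scope.

(** * The Euclidean norm *)

Section Euclid.
Variables (R : realType) (m : nat).
Implicit Types (x y z : 'rV[R]_m) (a : R).

Definition dot x y : R := \sum_i x ord0 i * y ord0 i.

Lemma dotC x y : dot x y = dot y x.
Proof. by apply: eq_bigr => i _; rewrite mulrC. Qed.

Lemma dotDl x y z : dot (x + y) z = dot x z + dot y z.
Proof. by rewrite -big_split; apply: eq_bigr => i _; rewrite mxE mulrDl. Qed.

Lemma dotZl a x y : dot (a *: x) y = a * dot x y.
Proof. by rewrite /dot mulr_sumr; apply: eq_bigr => i _; rewrite mxE mulrA. Qed.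

Lemma dotDr x y z : dot z (x + y) = dot z x + dot z y.
Proof. by rewrite dotC dotDl !(dotC z). Qed.

Lemma dotZr a x y : dot y (a *: x) = a * dot y x.
Proof. by rewrite dotC dotZl dotC. Qed.

Lemma dotNl x y : dot (- x) y = - dot x y.
Proof. by rewrite -scaleN1r dotZl mulN1r. Qed.

Lemma dotNr x y : dot y (- x) = - dot y x.
Proof. by rewrite dotC dotNl dotC. Qed.

Lemma dot_suml (I : finType) (f : I -> 'rV[R]_m) y :
  dot (\sum_i f i) y = \sum_i dot (f i) y.
Proof.
rewrite /dot exchange_big /=; apply: eq_bigr => i _.
by rewrite summxE mulr_suml.
Qed.

Lemma dot_sumr (I : finType) (f : I -> 'rV[R]_m) y :
  dot y (\sum_i f i) = \sum_i dot y (f i).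
Proof. by rewrite dotC dot_suml; apply: eq_bigr => i _; rewrite dotC. Qed.

Lemma dot_ge0 x : 0 <= dot x x.
Proof. by apply: sumr_ge0 => i _; rewrite -expr2 sqr_ge0. Qed.

Lemma enormE x : enorm x = Num.sqrt (dot x x).
Proof. by congr Num.sqrt; apply: eq_bigr => i _; rewrite expr2. Qed.

Lemma enorm_ge0 x : 0 <= enorm x.
Proof. exact: sqrtr_ge0. Qed.

Lemma sqr_enorm x : enorm x ^+ 2 = dot x x.
Proof. by rewrite enormE sqr_sqrtr // dot_ge0. Qed.

Lemma enorm_eq1 x : enorm x = 1 -> dot x x = 1.
Proof. by move=> x1; rewrite -sqr_enorm x1 expr1n. Qed.

Lemma dot_eq1 x : dot x x = 1 -> enorm x = 1.
Proof. by move=> x1; rewrite enormE x1 sqrtr1. Qed.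

Lemma dot_eq0 x : dot x x = 0 -> x = 0.
Proof.
move=> x0; apply/rowP => i; rewrite mxE; apply/eqP.
rewrite -sqrf_eq0 expr2; apply/eqP; apply: (psumr_eq0P _ x0) => // j _.
by rewrite -expr2 sqr_ge0.
Qed.

Lemma enormZ a x : enorm (a *: x) = `|a| * enorm x.
Proof.
rewrite !enormE dotZl dotZr mulrA -expr2 sqrtrM ?sqr_ge0 //.
by rewrite sqrtr_sqr.
Qed.

Lemma enorm0 : enorm (0 : 'rV[R]_m) = 0.
Proof. by rewrite -(scale0r 0) enormZ normr0 mul0r. Qed.

Lemma enormB x y : enorm (x - y) = enorm (y - x).
Proof. by rewrite -enormN opprB. Qed.

Lemma enorm_eq0 x : enorm x = 0 -> x = 0.
Proof. by move=> x0; apply: dot_eq0; rewrite -sqr_enorm x0 expr0n. Qed.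

Lemma cauchy_schwarz x y : dot x y <= enorm x * enorm y.
Proof.
have [x0|x0] := eqVneq (enorm x) 0.
  by rewrite (enorm_eq0 x0) enorm0 mul0r -(scale0r 0) dotZl mul0r.
have [y0|y0] := eqVneq (enorm y) 0.
  by rewrite (enorm_eq0 y0) enorm0 mulr0 -(scale0r 0) dotZr mul0r.
have xy0 : 0 < enorm x * enorm y by rewrite mulr_gt0 // lt0r enorm_ge0 ?x0 ?y0.
have := dot_ge0 (enorm y *: x - enorm x *: y).
rewrite !(dotDl, dotDr, dotNl, dotNr, dotZl, dotZr) (dotC y x) -!sqr_enorm.
set a := enorm x in xy0 *; set b := enorm y in xy0 *; set c := dot x y.
rewrite (_ : _ + _ = 2 * (a * b) * (a * b - c)); last by ring.
by rewrite pmulr_rge0 ?subr_ge0 // mulr_gt0.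
Qed.

Lemma enorm_triangle x y : enorm (x + y) <= enorm x + enorm y.
Proof.
rewrite -(@ler_pXn2r _ 2) ?nnegrE ?addr_ge0 ?enorm_ge0 //.
rewrite sqr_enorm dotDl !dotDr (dotC y x) sqrrD -!sqr_enorm.
by have := cauchy_schwarz x y; set c := dot x y; lra.
Qed.

Lemma enorm_dist_triangle z x y : enorm (x - y) <= enorm (x - z) + enorm (z - y).
Proof. by rewrite (le_trans _ (enorm_triangle _ _)) // addrA subrK. Qed.

End Euclid.

(** A walk along the quarter circle from (1,0) to (0,1) whose height [b] grows by [1 / M] at each
    step. *)
Lemma suspension_schedule (R : realType) (eta : R) : 0 < eta ->
  exists (M : nat) (a b : nat -> R),
    [/\ a 0 = 1 /\ b 0 = 0, a M = 0 /\ b M = 1,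
        forall t, (t <= M)%N -> a t ^+ 2 + b t ^+ 2 = 1 &
        forall t, (t < M)%N -> (a t - a t.+1) ^+ 2 + (b t - b t.+1) ^+ 2 <= eta ^+ 2].
Proof.
move=> eta0; have eta2 : 0 < eta ^+ 2 by rewrite exprn_gt0.
pose M := (Num.trunc (2 / eta ^+ 2)).+1.
have M0 : 0 < M%:R :> R by rewrite ltr0n.
have bM : 2 / M%:R <= eta ^+ 2.
  rewrite ler_pdivrMr // mulrC -ler_pdivrMr //.
  by apply/ltW/truncnS_gt.
pose b t : R := t%:R / M%:R; pose a t : R := Num.sqrt (1 - b t ^+ 2).
have b_ge0 t : 0 <= b t by rewrite divr_ge0 // ler0n.
have b_le1 t : (t <= M)%N -> b t <= 1 by move=> tM; rewrite ler_pdivrMr // mul1r ler_nat.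
have a2 t : (t <= M)%N -> a t ^+ 2 = 1 - b t ^+ 2.
  by move=> tM; rewrite sqr_sqrtr // subr_ge0 expr_le1 // b_le1.
exists M, a, b; split.
- by rewrite /a /b mul0r expr0n subr0 sqrtr1.
- by rewrite /a /b divff ?lt0r_neq0 // expr1n subrr sqrtr0.
- by move=> t tM; rewrite a2 // subrK.
move=> t tM.
have bS : b t.+1 = b t + M%:R^-1 by rewrite /b -natr1 mulrDl mul1r.
have Minv : 0 < M%:R^-1 :> R by rewrite invr_gt0.
have aS : a t.+1 <= a t.
  rewrite ler_sqrt ?subr_ge0 ?expr_le1 ?b_le1 //; last exact: ltnW.
  by rewrite lerB // ler_pXn2r ?nnegrE // bS lerDl ltW.
have aS0 : 0 <= a t.+1 by exact: sqrtr_ge0.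
(* With a' <= a and b <= b' for consecutive values, (a - a')^2 <= a^2 - a'^2 = b'^2 - b^2, so the
   squared step is at most 2 b' (b' - b) <= 2 / M. *)
have := a2 t (ltnW tM); have := a2 t.+1 tM; have := b_le1 t.+1 tM.
move: bM (b_ge0 t); rewrite bS; nra.
Qed.

(** * A finite Lyusternik-Schnirelmann theorem *)

Section FanChain.
Variables (R : realType) (d : nat) (eta : R).
Hypothesis eta_gt0 : 0 < eta.
Notation V := 'rV[R]_d.+1.
Implicit Types (F : seq V) (h : seq (seq V)).

Definition in_equator (i : nat) (x : V) :=
  enorm x = 1 /\ forall j : 'I_d.+1, (i < j)%N -> x ord0 j = 0.

(** The distance [d%:R * eta] bounds the diameter of every simplex in the chains below, so none of
    them carries complementary labels. *)
Definition antipodal_labelling F (lab : V -> nat) :=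
  {in F, forall p, lab (- p) = flip (lab p)} /\
  {in F &, forall p q, enorm (p - q) <= d%:R * eta -> lab q != flip (lab p)}.

Definition fan_odd (lab : V -> nat) h :=
  \big[addb/false]_(s <- h)
    (fan_cochain true (map lab s) (+) fan_cochain true (map lab (map -%R s))).

(** Each suspension adds one step of length [eta] to the diameter of the simplices, hence the bound
    [i%:R * eta]. *)
Definition fan_chain (i : nat) F h :=
  [/\ {in F, forall p, in_equator i p},
      {in h, forall s : seq V, size s = i.+1 /\ {subset s <= F}},
      {in h, forall s : seq V, {in s &, forall p q, enorm (p - q) <= i%:R * eta}},
      antipodal_cycle -%R h &
      forall lab, antipodal_labelling F lab -> fan_odd lab h].

Lemma fan_chain0 : fan_chain 0 [:: delta_mx ord0 ord0] [:: [:: delta_mx ord0 ord0]].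
Proof.
split.
- move=> p; rewrite inE => /eqP->; split.
    apply: dot_eq1; rewrite /dot big_ord_recl !mxE /= !mulr1 big1 ?addr0 // => i _.
    by rewrite mxE /= mul0r.
  by move=> j j0; rewrite mxE (_ : (j == ord0) = false) ?andbF // -val_eqE /= gtn_eqF.
- by move=> s; rewrite inE => /eqP->; split.
- move=> s; rewrite inE => /eqP-> p q; rewrite !inE => /eqP-> /eqP->.
  by rewrite subrr enorm0 mul0r.
(* [cobound] is augmented: both points have the empty simplex as boundary, and the two copies
   cancel. *)
- by move=> G; rewrite big_seq1 /= !addbF addbb.
move=> lab [labN _]; rewrite /fan_odd big_seq1 /= labN ?mem_head //.
by rewrite /fan_cochain /= odd_flip !andbT; case: odd.
Qed.

Lemma arc_dist (a b : R) (N x y : V) :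
  a ^+ 2 <= 1 -> enorm ((a *: x + b *: N) - (a *: y + b *: N)) <= enorm (x - y).
Proof.
move=> a1; rewrite opprD addrACA subrr addr0 -scalerBr enormZ.
by rewrite ler_piMl ?enorm_ge0 // -(@expr_le1 _ 2) // real_normK // num_real.
Qed.

(** The new chain is the suspension of [h] towards the pole [N] on the next coordinate axis. *)
Lemma fan_chainS i F h : (i < d)%N -> fan_chain i F h ->
  exists F' h', fan_chain i.+1 F' h'.
Proof.
move=> id_ [Feq hF hclose cyc hfan].
have [M [a [b [[a0 b0] [aM bM] ab abS]]]] := suspension_schedule eta_gt0.
pose N : V := delta_mx ord0 (inord i.+1).
have iv : (inord i.+1 : 'I_d.+1) = i.+1 :> nat by rewrite inordK.
have NN : dot N N = 1.
  rewrite /dot (bigD1 (inord i.+1)) //= !mxE !eqxx mulr1 big1 ?addr0 // => j ji.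
  by rewrite mxE (negbTE ji) andbF mul0r.
have NX x : in_equator i x -> dot x N = 0.
  move=> [_ x0]; rewrite /dot big1 // => j _; rewrite !mxE /=.
  by have [->|] := eqVneq j (inord i.+1); rewrite ?mulr0 // x0 ?iv ?mul0r.
pose f t (x : V) := a t *: x + b t *: N.
have f0 : f 0%N =1 id by move=> x; rewrite /f a0 b0 scale1r scale0r addr0.
have fM x : f M x = N by rewrite /f aM bM scale0r scale1r add0r.
have fx t x : (t <= M)%N -> in_equator i x -> in_equator i.+1 (f t x).
  move=> tM xE; split.
    apply: dot_eq1; rewrite /f !(dotDl, dotDr, dotZl, dotZr) NN (dotC N) NX //.
    by rewrite (enorm_eq1 xE.1) !mulr0 !mulr1 addr0 add0r -!expr2 ab.
  move=> j ij; rewrite !mxE xE.2 ?(ltn_trans _ ij) // mulr0 add0r /=.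
  by rewrite (_ : (j == _) = false) ?mulr0 // -val_eqE /= iv gtn_eqF.
have fS t x : (t < M)%N -> in_equator i x -> enorm (f t x - f t.+1 x) <= eta.
  move=> tM xE.
  have -> : f t x - f t.+1 x = (a t - a t.+1) *: x + (b t - b t.+1) *: N.
    by rewrite /f !scalerBl opprD addrACA.
  rewrite -(@ler_pXn2r _ 2) ?nnegrE ?enorm_ge0 ?(ltW eta_gt0) // sqr_enorm.
  rewrite !(dotDl, dotDr, dotZl, dotZr) NN (dotC N) NX // (enorm_eq1 xE.1).
  by rewrite !mulr0 !mulr1 addr0 add0r -!expr2 abS.
have size_h : {in h, forall s : seq V, size s = i.+1} by move=> s /hF[].
pose h' : seq (seq V) := suspension -%R f M h.
(* [F] is kept so that an antipodal labelling on [F'] is also one on [F]. *)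
pose F' : seq V := flatten h' ++ F.
have opp_eq x : in_equator i x -> in_equator i (- x).
  by move=> [x1 x0]; split => [|j ij]; rewrite ?enormN // mxE x0 // oppr0.
have mem_h' (s : seq V) : s \in h' -> size s = i.+2 /\ exists t (u : seq V),
    [/\ (t < M)%N, {in u, forall x, in_equator i x},
     {in u &, forall p q, enorm (p - q) <= i%:R * eta} &
     {in s, forall y, exists2 x, x \in u & y = f t x \/ y = f t.+1 x}].
  move/mem_suspension => [t [u [tM uh [su|su]]]]; split.
  - by rewrite (size_prism su) size_h.
  - exists t, u; split => //; first by move=> x xu; apply/Feq/(hF _ uh).2.
      exact: hclose.
    by move=> y; apply: mem_prism.
  - by rewrite (size_prism su) size_map size_h.
  exists t, (map -%R u); split => //.
  - by move=> x /mapP[z zu ->]; apply/opp_eq/Feq/(hF _ uh).2.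
  - move=> p q /mapP[p' pu ->] /mapP[q' qu ->].
    by rewrite -opprD enormN; apply: hclose uh _ _ pu qu.
  by move=> y; apply: mem_prism.
have h'close : {in h', forall s : seq V, {in s &, forall p q, enorm (p - q) <= i.+1%:R * eta}}.
  move=> s /mem_h'[_ [t [u [tM uE uclose su]]]] p q ps qs.
  have at1 r : (r <= M)%N -> a r ^+ 2 <= 1 by move=> /ab <-; rewrite lerDl sqr_ge0.
  have {at1} close r x y : (r <= M)%N -> x \in u -> y \in u ->
      enorm (f r x - f r y) <= i%:R * eta.
    by move=> rM xu yu; apply: le_trans (arc_dist _ _ _ _ (at1 _ rM)) (uclose _ _ xu yu).
  have [x xu px] := su p ps; have [y yu qy] := su q qs.
  have ie0 : 0 <= eta by exact: ltW.
  rewrite -natr1 mulrDl mul1r.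
  (* On one level, points are no farther apart than their originals in [u]; a change of level costs
     at most [eta]. *)
  case: px qy => -> [] ->.
  - by rewrite (le_trans (close _ _ _ (ltnW tM) xu yu)) // lerDl.
  - apply: le_trans (enorm_dist_triangle (f t y) _ _) _.
    exact: lerD (close _ _ _ (ltnW tM) xu yu) (fS _ _ tM (uE _ yu)).
  - apply: le_trans (enorm_dist_triangle (f t.+1 y) _ _) _.
    by apply: lerD (close _ _ _ tM xu yu) _; rewrite enormB; apply: fS tM (uE _ yu).
  - by rewrite (le_trans (close _ _ _ tM xu yu)) // lerDl.
have h'F s : s \in h' -> {subset s <= F'}.
  by move=> sh p ps; rewrite mem_cat; apply/orP; left; apply/flattenP; exists s.
exists F', h'; split => //.
- move=> p; rewrite mem_cat => /orP[/flattenP[s /mem_h'[_ [t [u [tM uE _ su]]]] ps]|pF].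
    by have [x xu []->] := su p ps; [apply: fx (ltnW tM) (uE _ xu)|apply: fx tM (uE _ xu)].
  by have [p1 p0] := Feq _ pF; split => // j ij; apply: p0; apply: ltn_trans ij.
- by move=> s sh'; split; [have [] := mem_h' _ sh'|exact: h'F].
- exact: (suspension_cycle (@opprK _) f0 fM size_h cyc).
move=> lab [labN labC].
have /hfan : antipodal_labelling F lab.
  by split=> [p pF|p q pF qF]; [apply: labN|apply: labC]; rewrite mem_cat ?pF ?qF orbT.
(* The parity for [h] is the coboundary of Ky Fan's cochain summed over [h'], which [cobound_fan]
   splits into the two summands of [fan_odd lab h']. *)
rewrite /fan_odd -(cobound_suspension f0 fM (fun s => fan_cochain true (map lab s)) size_h cyc).
apply: etrans; apply: eq_big_seq => s sh'.
rewrite cobound_map cobound_fan; congr (_ (+) _).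
rewrite -map_comp (eq_in_map _ (flip \o lab) _).1; last first.
  by move=> p ps /=; apply/labN/(h'F _ sh').
rewrite map_comp fan_cochain_flip //.
move=> j k /mapP[p ps ->] /mapP[q qs ->]; apply: labC; try exact: (h'F _ sh').
rewrite (le_trans (h'close _ sh' _ _ ps qs)) // ler_wpM2r ?ler_nat //.
exact: ltW.
Qed.

Lemma fan_chain_exists i : (i <= d)%N -> exists F h, fan_chain i F h.
Proof.
elim: i => [_|i IH id_]; first by eexists; eexists; exact: fan_chain0.
by have [F [h /(fan_chainS id_)]] := IH (ltnW id_).
Qed.

Lemma no_antipodal_labelling : exists2 F : seq V, {in F, forall p, enorm p = 1} &
  forall lab, antipodal_labelling F lab -> ~ {in F, forall p, lab p < d.*2}%N.
Proof.
have [F [h [Feq hF hclose _ hfan]]] := fan_chain_exists (leqnn d).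
exists F => [p /Feq[]//|lab labP small].
have [labN labC] := labP.
have := hfan _ labP; rewrite /fan_odd big1_seq // => s /= sh.
have [sz sF] := hF _ sh.
have nocomp : forall j k, j \in map lab s -> k \in map lab s -> k != flip j.
  move=> j k /mapP[p ps ->] /mapP[q qs ->]; apply: labC; try exact: sF.
  exact: hclose sh _ _ ps qs.
have noalt b : fan_cochain b (map lab s) = false.
  apply/negP => /(fan_cochain_size nocomp); rewrite size_map sz => /(_ d).
  rewrite ltnn => H; suff: false by []; apply: H => j /mapP[p ps ->].
  by apply/small/sF.
rewrite noalt -map_comp (eq_in_map _ (flip \o lab) _).1; last first.
  by move=> p ps /=; apply/labN/sF.
by rewrite map_comp fan_cochain_flip // noalt.
Qed.

End FanChain.

(** A colouring without such a pair would yield a forbidden labelling: the absolute value is the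
    smaller colour of [p] and [- p], the sign tells which of the two has it. *)
Lemma finite_lyusternik_schnirelmann (R : realType) (d : nat) (delta : R) :
  0 < delta ->
  exists2 F : seq 'rV[R]_d.+1, {in F, forall p, enorm p = 1} &
  forall c : 'rV[R]_d.+1 -> 'I_d.+1,
    exists p q, [/\ p \in F, q \in F, c p = c q & 2 - delta < enorm (p - q)].
Proof.
move=> delta0; pose eta := delta / (2 * d.+1%:R).
have d0 : 0 < 2 * d.+1%:R :> R by rewrite mulr_gt0 // ltr0n.
have eta0 : 0 < eta by rewrite divr_gt0.
have de : d%:R * eta < delta.
  rewrite /eta mulrCA gtr_pMr // ltr_pdivrMr // mul1r.
  by rewrite -natrM ltr_nat mul2n -addnn ltn_addr.
have [F F1 nolab] := no_antipodal_labelling d eta0.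
exists (F ++ map -%R F).
  by move=> p; rewrite mem_cat => /orP[/F1//|/mapP[q /F1 q1 ->]]; rewrite enormN.
move=> c; apply: contrapT => nomono.
have memF p : p \in F -> p \in F ++ map -%R F by move=> pF; rewrite mem_cat pF.
have memN p : p \in F -> - p \in F ++ map -%R F.
  by move=> pF; rewrite mem_cat map_f ?orbT.
(* 2 p = (p - q) + (p + q), so the norm of p + q is at least 2 minus that of p - q. *)
have far p q : p \in F -> enorm (p - q) <= d%:R * eta -> 2 - delta < enorm (p - - q).
  move=> /F1 p1 pq; rewrite opprK.
  have := enorm_triangle (p - q) (p + q).
  rewrite addrACA (addrC (- q)) subrr addr0 -mulr2n -scaler_nat enormZ p1 mulr1.
  by rewrite gtr0_norm // => /le_trans /(_ (lerD pq (lexx _))); lra.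
have cN p : p \in F -> c p != c (- p).
  move=> pF; apply/eqP => cp; apply: nomono; exists p, (- p); split=> //; [exact: memF|exact: memN|].
  by apply: far => //; rewrite subrr enorm0 mulr_ge0 // ltW.
(* [c p] and [c (- p)] differ, so the smaller one is below [d] *)
pose lab p := ((c p < c (- p)) + (minn (c p) (c (- p))).*2)%N.
have lab_odd p : odd (lab p) = (c p < c (- p))%N.
  by rewrite /lab oddD odd_double addbF; case: ltnP.
have lab_half p : (lab p)./2 = minn (c p) (c (- p)) by exact: half_bit_double.
apply: (nolab lab); first split.
- move=> p pF; rewrite -[LHS]odd_double_half -[RHS]odd_double_half.
  rewrite flip_half odd_flip !lab_half !lab_odd opprK minnC; congr (_ + _)%N.
  by have := cN p pF; rewrite -val_eqE /=; case: ltngtP.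
- move=> p q pF qF pq; apply/eqP => labq.
  have : odd (lab q) = ~~ odd (lab p) by rewrite labq odd_flip.
  have : (lab q)./2 = (lab p)./2 by rewrite labq flip_half.
  rewrite !lab_half !lab_odd => half_eq.
  have := cN p pF; have := cN q qF; rewrite -!val_eqE /= => cq cp.
  (* As the signs differ, the common minimum is the colour of both [p] and [- q], or of both [q] and
     [- p]: a nearly antipodal pair of one colour. *)
  case: (ltngtP (c p) (c (- p))) cp half_eq => // cp _.
    case: (ltngtP (c q) (c (- q))) cq => // cq _ half_eq _.
    apply: nomono; exists p, (- q); split; [exact: memF|exact: memN| |exact: far].
    by apply: val_inj; rewrite /= half_eq.
  case: (ltngtP (c q) (c (- q))) cq => // cq _ half_eq _.
  apply: nomono; exists q, (- p); split; [exact: memF|exact: memN| |].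
    by apply: val_inj; rewrite /= half_eq.
  by apply: far => //; rewrite enormB.
move=> p pF; rewrite /lab; have := cN p pF; rewrite -val_eqE /=.
have := ltn_ord (c p); have := ltn_ord (c (- p)); rewrite !ltnS.
case: (ltngtP (c p) (c (- p))) => // [lt|lt] le1 le2 _; rewrite /= ?add1n ?add0n.
  by rewrite -doubleS leq_double (leq_trans lt).
by rewrite ltn_double (leq_trans lt).
Qed.

(** * Regular simplices *)

Section Simplex.
Variables (R : realType) (d : nat) (v : 'I_d.+2 -> 'rV[R]_d.+1).
Hypothesis v_simplex : regular_inscribed_simplex v.
Implicit Types w z : 'I_d.+2 -> R.

Lemma simplex_gram : exists2 g : R, g != 1 &
  forall i j, dot (v i) (v j) = g + (1 - g) * (i == j)%:R.
Proof.
have [v1' [s s0 vs]] := v_simplex; have v1 : forall i, enorm (v i) = 1 := v1'.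
exists (1 - s ^+ 2 / 2).
  rewrite -subr_eq0 addrAC subrr add0r oppr_eq0 mulf_neq0 ?expf_neq0 ?gt_eqF //.
move=> i j; have [<-|ij] := eqVneq i j; first by rewrite enorm_eq1 //= mulr1n mulr1 addrC subrK.
have := sqr_enorm (v i - v j); rewrite (vs _ _ ij).
rewrite !(dotDl, dotDr, dotNl, dotNr) (dotC (v j)) !enorm_eq1 //.
by rewrite /= mulr0n mulr0 addr0 => ->; field.
Qed.

(** The right-hand side does not change when both families of weights are permuted alike; this makes
    the facets congruent. *)
Lemma dot_simplex_comb : exists g : R, forall w z,
  dot (\sum_i w i *: v i) (\sum_i z i *: v i) =
  g * (\sum_i w i) * (\sum_i z i) + (1 - g) * \sum_i w i * z i.
Proof.
have [g _ gram] := simplex_gram; exists g => w z.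
transitivity (\sum_i \sum_j (g * w i * z j + (1 - g) * (w i * z j) * (i == j)%:R)).
  rewrite dot_suml; apply: eq_bigr => i _; rewrite dot_sumr; apply: eq_bigr => j _.
  by rewrite dotZl dotZr gram; ring.
under eq_bigr do rewrite big_split /= -mulr_sumr.
rewrite big_split /= -mulr_suml -mulr_sumr; congr (_ + _).
rewrite mulr_sumr; apply: eq_bigr => i _.
rewrite (bigD1 i) //= eqxx mulr1 big1 ?addr0 // => j ji.
by rewrite eq_sym (negbTE ji) mulr0.
Qed.

Let vmx : 'M[R]_(d.+2, d.+1) := \matrix_i v i.

Lemma mul_vmx (u : 'rV[R]_d.+2) : u *m vmx = \sum_i u ord0 i *: v i.
Proof. by rewrite mulmx_sum_row; apply: eq_bigr => i _; rewrite rowK. Qed.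

(** The inner product of the relation with [v i] expresses [(1 - g) * u ord0 i] by a quantity
    independent of [i]. *)
Lemma simplex_kernel (u : 'rV[R]_d.+2) : u *m vmx = 0 -> forall i j, u ord0 i = u ord0 j.
Proof.
have [g g1 gram] := simplex_gram; rewrite mul_vmx => u0.
have E i : (1 - g) * u ord0 i = - (g * \sum_j u ord0 j).
  apply/eqP; rewrite -addr_eq0 addrC; apply/eqP.
  transitivity (dot (\sum_i u ord0 i *: v i) (v i)); last by rewrite u0 -(scale0r 0) dotZl mul0r.
  rewrite dot_suml; under [RHS]eq_bigr do rewrite dotZl gram mulrDr.
  rewrite big_split /= -mulr_suml mulrC; congr (_ + _).
  rewrite (bigD1 i) //= eqxx mulr1 mulrC big1 ?addr0 // => j ji.
  by rewrite (negbTE ji) !mulr0.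
move=> i j; have := E i; rewrite -(E j); apply: mulfI.
by rewrite subr_eq0 eq_sym.
Qed.

(** d+2 vectors of a space of dimension d+1 are dependent, and by [simplex_kernel] a nontrivial
    relation has equal coefficients. *)
Lemma simplex_centroid : \sum_i v i = 0.
Proof.
have : kermx vmx != 0.
  rewrite -mxrank_eq0 mxrank_ker subn_eq0 -ltnNge ltnS.
  exact: rank_leq_col.
case/rowV0Pn => u /sub_kermxP u0 unz.
have uc := simplex_kernel u0.
have : u ord0 ord0 *: (\sum_i v i) = 0.
  apply: etrans u0; rewrite mul_vmx scaler_sumr.
  by apply: eq_bigr => i _; rewrite (uc ord0 i).
move/eqP; rewrite scaler_eq0 => /orP[/eqP u00|/eqP//].
by case/eqP: unz; apply/rowP => i; rewrite (uc i ord0) u00 mxE.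
Qed.

(** The relations among the [v i] form at most a line, so the rank is at least d+1. *)
Lemma simplex_span (x : 'rV[R]_d.+1) : exists c, x = \sum_i c i *: v i.
Proof.
have full : row_full vmx.
  rewrite /row_full eqn_leq rank_leq_col /=.
  have : (kermx vmx <= (const_mx 1 : 'rV[R]_d.+2))%MS.
    apply/rV_subP => u /sub_kermxP /simplex_kernel uc.
    apply/submxP; exists (const_mx (u ord0 ord0)).
    by apply/rowP => i; rewrite !mxE big_ord1 !mxE mulr1 (uc i ord0).
  move/mxrankS; rewrite mxrank_ker => /leq_trans /(_ (rank_leq_row _)).
  by rewrite leq_subLR addn1 ltnS.
have /submxP[c ->] := submx_full x full.
by exists (fun i => c ord0 i); rewrite mul_vmx.
Qed.

(** As the vertices sum to 0, the least coefficient of [x] can be subtracted from all; the weights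
    become nonnegative and vanish at its index [k]. *)
Lemma facets_cover (x : 'rV[R]_d.+1) : sphere x ->
  exists k, (@radial_proj R d @` facet v k) x.
Proof.
move=> x1; have [c xc] := simplex_span x.
pose k := [arg min_(i < ord0) c i]%O.
have ck i : c k <= c i by rewrite /k; case: arg_minP => // j _; apply.
pose w i := c i - c k; have w_ge0 i : 0 <= w i by rewrite subr_ge0.
have xw : x = \sum_i w i *: v i.
  rewrite xc /w; under [RHS]eq_bigr do rewrite scalerBl.
  by rewrite sumrB -scaler_sumr simplex_centroid scaler0 subr0.
pose S := \sum_i w i.
have S0 : 0 < S.
  rewrite lt0r sumr_ge0 ?andbT //; apply/eqP => /psumr_eq0P w0.
  have : x = 0 by rewrite xw big1 // => i _; rewrite w0 ?scale0r.
  by move=> x0; move: x1; rewrite /sphere /= x0 enorm0 => /eqP; rewrite eq_sym oner_eq0.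
exists k, (S^-1 *: x).
  exists (fun i => S^-1 * w i); split.
  - by move=> i; rewrite mulr_ge0 // invr_ge0 ltW.
  - by rewrite /w subrr mulr0.
  - by rewrite -mulr_sumr mulVf ?gt_eqF.
  - by rewrite xw scaler_sumr; apply: eq_bigr => i _; rewrite scalerA.
rewrite /radial_proj enormZ x1 mulr1 gtr0_norm ?invr_gt0 // invrK scalerA.
by rewrite divff ?scale1r ?gt_eqF.
Qed.

(** Only an inequality, because [0^-1 = 0] sends the zero vector to itself. *)
Lemma enorm_radial_proj (x : 'rV[R]_d.+1) : enorm (radial_proj x) <= 1.
Proof.
rewrite /radial_proj enormZ ger0_norm ?invr_ge0 ?enorm_ge0 //.
by have [->|x0] := eqVneq (enorm x) 0; rewrite ?mulr0 ?ler01 // mulVf.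
Qed.

Lemma enorm_combB (a b : R) (x y : 'rV[R]_d.+1) :
  enorm (a *: x - b *: y) =
  Num.sqrt (a ^+ 2 * dot x x - 2 * a * b * dot x y + b ^+ 2 * dot y y).
Proof.
rewrite enormE !(dotDl, dotDr, dotNl, dotNr, dotZl, dotZr) (dotC y x).
by congr Num.sqrt; ring.
Qed.

Lemma facet_dist_le (k k' : 'I_d.+2) (x y : 'rV[R]_d.+1) :
  (@radial_proj R d @` facet v k') x -> (@radial_proj R d @` facet v k') y ->
  enorm (x - y) <= lambda v k.
Proof.
have [g dotE] := dot_simplex_comb.
pose s : {perm 'I_d.+2} := tperm k k'.
(* permuting the barycentric weights preserves the Gram matrix, so the projections
   of all facets are congruent *)
pose V w : 'rV[R]_d.+1 := \sum_i w i *: v i.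
have dot_perm w z : dot (V (w \o s)) (V (z \o s)) = dot (V w) (V z).
  rewrite !dotE.
  by congr (_ * _ * _ + _ * _); rewrite [RHS](reindex_inj (@perm_inj _ s)).
have facet_perm w : (forall i, 0 <= w i) -> w k' = 0 -> \sum_i w i = 1 ->
    facet v k (V (w \o s)).
  move=> w0 wk w1; exists (w \o s); split=> //=; first by rewrite tpermL.
  by rewrite -w1 [RHS](reindex_inj (@perm_inj _ s)).
move=> [_ [w [w0 wk w1 ->]] <-] [_ [z [z0 zk z1 ->]] <-].
have -> : enorm (radial_proj (V w) - radial_proj (V z)) =
   enorm (radial_proj (V (w \o s)) - radial_proj (V (z \o s))).
  by rewrite /radial_proj !enorm_combB !enormE !dot_perm.
apply: sup_ubound; last first.
  by exists (radial_proj (V (w \o s))), (radial_proj (V (z \o s))); split => //;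
    eexists=> //; apply: facet_perm.
exists 2 => _ [p [q [[p' _ <-] [q' _ <-] ->]]].
rewrite (le_trans (enorm_triangle _ _)) // enormN.
by have := enorm_radial_proj p'; have := enorm_radial_proj q'; lra.
Qed.

Lemma lambda_ge0 k : 0 <= lambda v k.
Proof.
have [v1 _] := v_simplex; have [k' vk'] := facets_cover (v1 ord0).
by have := facet_dist_le k vk' vk'; rewrite subrr enorm0.
Qed.

Lemma borsuk_colorable (k : 'I_d.+2) (eps : R) (n : nat) (x : 'I_n -> 'rV[R]_d.+1) :
  eps < 2 - lambda v k -> (forall i, sphere (x i)) ->
  colorable (borsuk_graph eps x) d.+2.
Proof.
move=> epsl x1; have [f fP] := choice (fun i => facets_cover (x1 i)).
apply/existsP; exists [ffun i => f i]; apply/forallP => i; apply/forallP => j.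
apply/implyP => /andP[_ far]; rewrite !ffunE; apply/eqP => fij.
have := facet_dist_le k (fP i); rewrite fij => /(_ _ (fP j)).
by move: far epsl; lra.
Qed.
End Simplex.

(** * Caps of the sphere *)

Section Householder.
Variables (R : realType) (m : nat).
Implicit Types (x y p q w : 'rV[R]_m) (U : 'M[R]_m).

Lemma dot_mulmx x y : x *m y^T = (dot x y)%:M.
Proof.
apply/matrixP => i j; rewrite !ord1 !mxE eqxx mulr1n; apply: eq_bigr => k _.
by rewrite mxE.
Qed.

Lemma dot_orthogonal U x y : U *m U^T = 1%:M -> dot (x *m U) (y *m U) = dot x y.
Proof.
move=> UU; have := dot_mulmx (x *m U) (y *m U).
rewrite trmx_mul mulmxA -(mulmxA x) UU mulmx1 dot_mulmx.
by move/matrixP => /(_ ord0 ord0); rewrite !mxE eqxx !mulr1n.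
Qed.

Lemma enorm_orthogonal U x : U *m U^T = 1%:M -> enorm (x *m U) = enorm x.
Proof. by move=> UU; rewrite !enormE dot_orthogonal. Qed.

Lemma trmx_1subZ U (c : R) : U^T = U -> (1%:M - c *: U)^T = 1%:M - c *: U.
Proof.
move=> UT; apply/matrixP => i j; have := congr1 (fun M : 'M[R]_m => M i j) UT.
by rewrite !mxE => ->; rewrite eq_sym.
Qed.

(* the Householder reflection in the hyperplane bisecting [p] and [q] *)
Lemma orthogonal_transitive p q : enorm p = 1 -> enorm q = 1 ->
  exists2 U : 'M[R]_m, U *m U^T = 1%:M & p *m U = q.
Proof.
move=> p1 q1; have [<-|pq] := eqVneq p q.
  by exists 1%:M; rewrite ?trmx1 mulmx1.
pose w := p - q; pose c := 2 / dot w w.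
have w0 : dot w w != 0 by apply: contraNneq pq => /dot_eq0/eqP; rewrite subr_eq0.
have wwE : dot w w = 2 - 2 * dot p q.
  rewrite /w !(dotDl, dotDr, dotNl, dotNr) (dotC q p) !enorm_eq1 //; ring.
pose H : 'M[R]_m := w^T *m w.
have HT : H^T = H by rewrite /H trmx_mul trmxK.
have HH : H *m H = dot w w *: H.
  by rewrite /H mulmxA -(mulmxA w^T) dot_mulmx mul_mx_scalar -scalemxAl.
exists (1%:M - c *: H).
  rewrite trmx_1subZ //.
  rewrite mulmxBl mul1mx mulmxBr mulmx1 -scalemxAl -scalemxAr HH !scalerA.
  rewrite (_ : c * c * dot w w = c + c); last by rewrite /c; field.
  by rewrite scalerDl opprB addrK subrK.
rewrite mulmxBr mulmx1 -scalemxAr /H mulmxA dot_mulmx mul_scalar_mx scalerA.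
(* For unit vectors, [dot w w] is twice [dot p w]. *)
have -> : c * dot p w = 1.
  rewrite /c wwE /w dotDr dotNr (enorm_eq1 p1).
  by rewrite wwE in w0; field; move: w0; apply: contraNneq => E; apply/eqP; lra.
by rewrite scale1r /w opprB addrC subrK.
Qed.

End Householder.

(** * Open caps and compactness of the sphere *)

Section Topology.
Variables (R : realType) (d : nat).
Notation V := 'rV[R]_d.+1.

Definition cap (p : V) (r : R) : set V := [set x | enorm (x - p) < r].

Lemma enorm_dist_continuous (p : V) : continuous (fun x : V => enorm (x - p)).
Proof.
move=> x; apply: (@continuous_comp _ _ _
  (fun x : V => \sum_(i < d.+1) (x - p) ord0 i ^+ 2) Num.sqrt); last exact: sqrt_continuous.
apply: (@cvg_big _ _ _ _ _ add_continuous _ _ _ _ _ (nbhs_filter x)) => i _.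
under eq_cvg do rewrite !mxE.
rewrite !mxE; apply: (@continuous_comp _ _ _
  (fun x : V => x ord0 i - p ord0 i) (fun y => y ^+ 2)); last exact: exprn_continuous.
by apply: continuousB; [exact: coord_continuous|exact: cst_continuous].
Qed.

Lemma open_cap p r : open (cap p r).
Proof.
apply: (@open_comp _ _ (fun x : V => enorm (x - p)) [set y | y < r]); last exact: open_lt.
by move=> x _; exact: enorm_dist_continuous.
Qed.

Lemma closed_sphere : closed (@sphere R d).
Proof.
have -> : @sphere R d = (fun x : V => enorm (x - 0)) @^-1` [set 1].
  by apply/seteqP; split => x; rewrite /sphere /= subr0.
apply: closed_comp; last exact: closed_eq.
by move=> x _; exact: enorm_dist_continuous.
Qed.

Lemma compact_sphere : compact (@sphere R d).
Proof.
apply: bounded_closed_compact; last exact: closed_sphere.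
exists 1; split; first exact: num_real.
(* Boundedness refers to the sup norm; the square of each coordinate is at most the sum of all
   squares, which is 1. *)
move=> M M1 x x1 /=; rewrite [leLHS]/Num.Def.normr /= mx_normrE.
apply: bigmax_le => [|[i j] _ /=]; first by rewrite ltW // (lt_trans _ M1).
rewrite ord1 (le_trans _ (ltW M1)) // -(@expr_le1 _ 2) // real_normK ?num_real //.
rewrite -(enorm_eq1 x1) /dot (bigD1 j) //= expr2 lerDl.
by apply: sumr_ge0 => k _; rewrite -expr2 sqr_ge0.
Qed.

Lemma sphere_finite_cover (r : R) : 0 < r ->
  exists2 s : seq V, {in s, forall p, sphere p} &
    @sphere R d `<=` \big[setU/set0]_(p <- s) cap p r.
Proof.
move=> r0; have := compact_sphere; rewrite compact_cover => cc.
have [|x x1|D Dsub Dcov] := cc V (@sphere R d) (fun p => cap p r).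
- by move=> p _; exact: open_cap.
- by exists x => //; rewrite /cap /= subrr enorm0.
exists (enum_fset D) => [p pD|x /Dcov [p pD px]].
  exact: set_mem (Dsub p pD).
by rewrite -bigcup_seq; exists p.
Qed.

End Topology.

(** * Random Borsuk graphs *)

Lemma colorableS (V : finType) (G : sgraph V) k : colorable G k -> colorable G k.+1.
Proof.
move=> /existsP[f /forallP fP]; apply/existsP; exists [ffun x => widen_ord (leqnSn k) (f x)].
apply/forallP => x; apply/forallP => y; apply/implyP => /(implyP (forallP (fP x) y)).
by rewrite !ffunE.
Qed.

Lemma chromatic_numberP (V : finType) (G : sgraph V) k :
  chromatic_number G = k.+1 <-> colorable G k.+1 /\ ~~ colorable G k.
Proof.
have mono j l : (j <= l)%N -> colorable G j -> colorable G l.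
  by move=> /subnK <-; elim: (l - j)%N => // i IH /IH; exact: colorableS.
rewrite /chromatic_number; case: ex_minnP => m mc m_min; split.
  move=> mE; rewrite mE in mc m_min; split => //.
  by apply/negP => /m_min; rewrite ltnn.
move=> [ck nck]; apply/eqP; rewrite eqn_leq m_min //= ltnNge.
by apply: contra nck => mk; apply: mono mc.
Qed.

Lemma borsuk_not_colorable (R : realType) (d : nat) (eps : R) :
  0 < eps -> eps < 2 ->
  exists2 F : seq 'rV[R]_d.+1, {in F, forall p, sphere p} &
  forall n (x : 'I_n -> 'rV[R]_d.+1),
    (forall p, p \in F -> exists i, cap p (eps / 4) (x i)) ->
    ~~ colorable (borsuk_graph eps x) d.+1.
Proof.
(* Half of [eps] is spent on the pair in [F], the other half on moving its two points by [eps / 4]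
   each to sample points. *)
move=> eps0 eps2; have de0 : 0 < eps / 2 by rewrite divr_gt0.
have [F F1 FLS] := finite_lyusternik_schnirelmann d de0.
exists F => // n x near_x; apply/negP => /existsP[f /forallP fP].
have [c cP] : exists c : 'rV[R]_d.+1 -> 'I_d.+1, forall p, p \in F ->
    exists2 i, cap p (eps / 4) (x i) & c p = f i.
  suff /choice[c cP] : forall p, exists k : 'I_d.+1, p \in F ->
      exists2 i, cap p (eps / 4) (x i) & k = f i by exists c.
  move=> p; have [/near_x[i pi]|pF] := boolP (p \in F); last by exists ord0.
  by exists (f i) => _; exists i.
have [p [q [pF qF cpq far]]] := FLS c.
have [i pi ci] := cP _ pF; have [j qj cj] := cP _ qF.
have {}far : 2 - eps < enorm (x i - x j).
  have := enorm_dist_triangle (x i) p q; have := enorm_dist_triangle (x j) (x i) q.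
  by move: pi qj far; rewrite /cap /= (enormB (x i) p); lra.
have ij : i != j.
  by apply/eqP => ij; move: far; rewrite ij subrr enorm0; lra.
have := implyP (forallP (fP i) j); rewrite /= /borsuk_rel ij far -ci -cj cpq eqxx.
by move/(_ isT).
Qed.

(** * The measure of a cap *)

Section Measure.
Variables (R : realType) (d : nat).

Lemma measurable_open_rV (A : set 'rV[R]_d.+1) :
  open A -> measurable (A : set (borel_rV R d)).
Proof. by move=> oA; apply: sub_sigma_algebra. Qed.

Lemma measurable_sphere : measurable (@sphere R d : set (borel_rV R d)).
Proof.
rewrite -[X in measurable X]setCK; apply: measurableC; apply: measurable_open_rV.
by apply: closed_openC; exact: closed_sphere.
Qed.

Lemma measure_big_setU_le disp (T : measurableType disp) (mu : probability T R)
    (I : Type) (s : seq I) (A : I -> set T) : (forall i, measurable (A i)) ->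
  (mu (\big[setU/set0]_(i <- s) A i) <= \sum_(i <- s) mu (A i))%E.
Proof.
move=> mA; elim: s => [|i s IH]; first by rewrite !big_nil measure0.
rewrite !big_cons (le_trans (measureU2 _ _ _)) ?leeD2l //.
exact: bigsetU_measurable.
Qed.

Lemma uniform_cap_ge (r : R) : 0 < r ->
  exists2 c : R, 0 < c < 1 &
  forall (mu : probability (borel_rV R d) R), uniform_on_sphere mu ->
    forall p, sphere p -> (c%:E <= mu (cap p r))%E.
Proof.
move=> r0; have [s s1 scov] := @sphere_finite_cover R d _ r0.
(* The cover gives the bound [1 / size s]; [.+2] keeps the constant positive and below 1 whatever
   [s] is. *)
exists (size s).+2%:R^-1; first by rewrite invr_gt0 ltr0n invf_lt1 ?ltr1n ?ltr0n.
move=> mu [mu1 muU] p p1.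
have mcap q : measurable (cap q r : set (borel_rV R d)).
  by apply: measurable_open_rV; exact: open_cap.
have cap_eq q : q \in s -> mu (cap q r) = mu (cap p r).
  move=> /s1 q1; have [U UU pU] := orthogonal_transitive p1 q1.
  rewrite -(muU _ _ UU (mcap q)); congr (mu _); apply/seteqP.
  by split => x; rewrite /cap /= -pU -mulmxBl enorm_orthogonal.
have : (1 <= \sum_(q <- s) mu (cap q r))%E.
  rewrite -mu1 (le_trans _ (measure_big_setU_le _ _ mcap)) //.
  apply: le_measure => //; rewrite inE; first exact: measurable_sphere.
  exact: bigsetU_measurable.
rewrite (eq_big_seq (fun=> mu (cap p r)) cap_eq) -(fineK (fin_num_measure mu _ (mcap p))).
rewrite sumEFin !lee_fin big_const_seq count_predT iter_addr_0 => le1.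
rewrite -div1r ler_pdivrMr ?ltr0n // (le_trans le1) // mulr_natr.
by rewrite ler_wpMn2l ?fine_ge0 // ltnW.
Qed.
End Measure.

(** * Measurability and probability of the colouring events *)

Section Events.
Variables (R : realType) (d n : nat) (eps : R) (disp : measure_display)
  (T : measurableType disp) (P : probability T R) (X : 'I_n -> {RV P >-> borel_rV R d}).

Lemma measurable_preimage_RV i (A : set (borel_rV R d)) :
  measurable A -> measurable (X i @^-1` A).
Proof. by move=> mA; rewrite -[_ @^-1` _]setTI; exact: measurable_funP. Qed.

Lemma measurable_coord_RV i k : measurable_fun setT (fun w => (X i w : 'rV[R]_d.+1) ord0 k).
Proof.
apply: (measurability _ (RGenOpens.measurableE R)).
move=> _ [_ [a [b ->] <-]]; rewrite setTI.
apply: (@measurable_preimage_RV i ((fun x : 'rV[R]_d.+1 => x ord0 k) @^-1` `]a, b[%classic)).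
apply: measurable_open_rV; apply: open_comp; last exact: interval_open.
by move=> x _; exact: coord_continuous.
Qed.

Lemma measurable_dist_RV i j : measurable [set w | 2 - eps < enorm (X i w - X j w)].
Proof.
have mf : measurable_fun setT (fun w => enorm (X i w - X j w)).
  apply: (measurableT_comp (f := @Num.sqrt R)).
    by apply: continuous_measurable_fun; exact: sqrt_continuous.
  apply: measurable_sum => k; apply: measurable_funX.
  under eq_fun do rewrite !mxE.
  by apply: measurable_funB; exact: measurable_coord_RV.
rewrite -[X in measurable X]setTI.
rewrite (_ : [set w | _] = (fun w => enorm (X i w - X j w)) @^-1` `]2 - eps, +oo[%classic).
  by apply: mf => //; exact: measurable_itv.
by apply/seteqP; split => w /=; rewrite in_itv /= andbT.
Qed.

Lemma measurable_colorable k :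
  measurable [set w | colorable (borsuk_graph eps (X ^~ w)) k].
Proof.
pose E (f : {ffun 'I_n -> 'I_k}) i j :=
  [set w | borsuk_graph eps (X ^~ w) i j ==> (f i != f j)].
have mfull (S : set T) : (forall w, S w) -> measurable S.
  by move=> SE; rewrite (_ : S = setT) //; apply/seteqP; split.
have mE f i j : measurable (E f i j).
  have [fij|fij] := boolP (f i != f j).
    by apply: mfull => w; rewrite /E /= fij implybT.
  have [ij|ij] := eqVneq i j.
    by apply: mfull => w; rewrite /E /= /borsuk_rel ij eqxx.
  rewrite (_ : E f i j = ~` [set w | 2 - eps < enorm (X i w - X j w)]).
    by apply: measurableC; exact: measurable_dist_RV.
  rewrite /E /= /borsuk_rel ij (negbTE fij).
  by apply/seteqP; split => w /=; rewrite implybF => /negP.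
(* Colourability is a finite union over colourings of finite intersections over pairs of
   vertices. *)
rewrite (_ : [set w | _] = \bigcup_(f in setT) \bigcap_(i in setT) \bigcap_(j in setT) E f i j).
  apply: fin_bigcup_measurable => [|f _]; first exact: finite_finset.
  apply: fin_bigcap_measurable => [|i _]; first exact: finite_finset.
  by apply: fin_bigcap_measurable => [|j _]; first exact: finite_finset.
apply/seteqP; split => w /=.
  by move=> /existsP[f /forallP fP]; exists f => // i _ j _; exact: (forallP (fP i)).
by move=> [f _ fP]; apply/existsP; exists f; apply/forallP => i; apply/forallP => j; exact: fP.
Qed.

Lemma measurable_chromatic k :
  measurable [set w | chromatic_number (borsuk_graph eps (X ^~ w)) = k.+1].
Proof.
rewrite (_ : [set w | _] = [set w | colorable (borsuk_graph eps (X ^~ w)) k.+1] `\`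
   [set w | colorable (borsuk_graph eps (X ^~ w)) k]).
  by apply: measurableD; exact: measurable_colorable.
apply/seteqP; split => w /=; rewrite chromatic_numberP => -[ck nck]; split => //; exact/negP.
Qed.

Hypotheses (X_unif : forall i, uniform_on_sphere (distribution P (X i)))
  (X_indep : mutually_independent X).

Lemma prob_miss_cap (c r : R) p :
  (forall i, c%:E <= distribution P (X i) (cap p r))%E ->
  (P (\bigcap_(i in setT) X i @^-1` ~` cap p r) <= ((1 - c) ^+ n)%:E)%E.
Proof.
move=> cle; have mcap : measurable (cap p r : set (borel_rV R d)).
  by apply: measurable_open_rV; exact: open_cap.
have := X_indep [set: 'I_n]%SET (fun i => measurableC mcap).
rewrite (_ : [set i | _] = setT); last by apply/seteqP; split => i //=; rewrite inE.
move=> ->.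
pose q i := fine (P (X i @^-1` cap p r)).
have mpre i := measurable_preimage_RV i mcap.
have qf i : (q i)%:E = P (X i @^-1` cap p r) by apply: fineK; exact: fin_num_measure.
have qE i : P (X i @^-1` ~` cap p r) = (1 - q i)%:E.
  rewrite -preimage_setC probability_setC; last exact: mpre.
  by rewrite -[P _]qf.
rewrite (eq_bigr _ (fun i _ => qE i)) prodEFin lee_fin.
have q1 i : q i <= 1 by rewrite -lee_fin qf probability_le1.
have qc i : c <= q i by rewrite -lee_fin qf; exact: cle.
rewrite -[X in _ ^+ X](card_ord n) -cardsT -prodr_const.
by apply: ler_prod => i _; rewrite subr_ge0 q1 lerB.
Qed.

(** Union bound over the points of [F]: outside [bad], the sample lies on the sphere and comes near
    every point of [F], so both colouring bounds apply. *)
Lemma prob_chromatic_ge (v : 'I_d.+2 -> 'rV[R]_d.+1) (k : 'I_d.+2) (c : R)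
    (F : seq 'rV[R]_d.+1) :
  regular_inscribed_simplex v -> eps < 2 - lambda v k ->
  (forall i p, p \in F -> c%:E <= distribution P (X i) (cap p (eps / 4)))%E ->
  (forall x : 'I_n -> 'rV[R]_d.+1,
    (forall p, p \in F -> exists i, cap p (eps / 4) (x i)) ->
    ~~ colorable (borsuk_graph eps x) d.+1) ->
  ((1 - (size F)%:R * (1 - c) ^+ n)%:E <=
    P [set w | chromatic_number (borsuk_graph eps (X ^~ w)) = d.+2])%E.
Proof.
move=> vS epsl cF noncol.
(* The sample points lie on the sphere only almost surely, so this null event is set aside. *)
pose off := \big[setU/set0]_i (X i @^-1` ~` @sphere R d).
pose miss p := \bigcap_(i in setT) (X i @^-1` ~` cap p (eps / 4)).
pose bad := off `|` \big[setU/set0]_(p <- F) miss p.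
have moff i : measurable (X i @^-1` ~` @sphere R d).
  by apply: measurable_preimage_RV; apply: measurableC; exact: measurable_sphere.
have mmiss p : measurable (miss p).
  apply: fin_bigcap_measurable => [|i _]; first exact: finite_finset.
  by apply: measurable_preimage_RV; apply: measurableC; apply: measurable_open_rV; exact: open_cap.
have mU1 : measurable off by exact: bigsetU_measurable.
have mU2 : measurable (\big[setU/set0]_(p <- F) miss p) by exact: bigsetU_measurable.
have mbad : measurable bad by exact: measurableU.
have off0 : P off = 0%E.
  apply/eqP; rewrite -measure_le0 (le_trans (measure_big_setU_le _ _ moff)) //.
  rewrite big1 // => i _; rewrite -preimage_setC probability_setC; last first.
    by apply: measurable_preimage_RV; exact: measurable_sphere.
  by have [E _] := X_unif i; rewrite [P _]E subee.
have bad_le : (P bad <= ((size F)%:R * (1 - c) ^+ n)%:E)%E.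
  apply: (@le_trans _ _ (P off + P (\big[setU/set0]_(p <- F) miss p))%E); first exact: measureU2.
  rewrite off0 add0e.
  rewrite (le_trans (measure_big_setU_le _ _ mmiss)) //.
  rewrite mulr_natl -iter_addr_0 -count_predT -big_const_seq -sumEFin.
  rewrite big_seq [leRHS]big_seq; apply: lee_sum => p pF.
  by apply: prob_miss_cap => i; exact: cF.
rewrite (@le_trans _ _ (P (~` bad))) //.
  rewrite probability_setC // -(fineK (fin_num_measure P _ mbad)) -EFinB lee_fin lerB //.
  by rewrite -lee_fin fineK // fin_num_measure.
apply: le_measure; rewrite ?inE; [exact: measurableC|exact: measurable_chromatic|].
move=> w /= /not_orP[noff nmiss]; apply/chromatic_numberP; split.
  apply: (borsuk_colorable vS epsl) => i; apply: contrapT => ni; apply: noff.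
  by rewrite /off -bigcup_seq; exists i => //=; rewrite mem_index_enum.
apply: noncol => p pF; apply: contrapT => nex; apply: nmiss.
rewrite -bigcup_seq; exists p => // i _ capi; apply: nex; by exists i.
Qed.
End Events.

Theorem theorem1 (R : realType) (d : nat) (d_ge1 : (1 <= d)%N)
  (v : 'I_d.+2 -> 'rV[R]_d.+1) (v_simplex : regular_inscribed_simplex v)
  (k : 'I_d.+2)
  (eps : R) (eps_gt0 : 0 < eps) (eps_lt : eps < 2 - lambda v k)
  (disp : nat -> measure_display)
  (Omega : forall n : nat, measurableType (disp n))
  (P : forall n : nat, probability (Omega n) R)
  (X : forall n : nat, 'I_n -> {RV (P n) >-> borel_rV R d})
  (X_unif : forall (n : nat) (i : 'I_n),
     uniform_on_sphere (distribution (P n) (X n i)))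
  (X_indep : forall n : nat, mutually_independent (X n)) :
  (fun n : nat =>
     P n [set w | chromatic_number (borsuk_graph eps (fun i => X n i w))
                  = d.+2])
    @ \oo --> 1%:E.
Proof.
have eps_lt2 : eps < 2 by have := lambda_ge0 v_simplex k; lra.
have [F F1 noncol] := borsuk_not_colorable d eps_gt0 eps_lt2.
have eps4 : 0 < eps / 4 by rewrite divr_gt0.
have [c /andP[c0 c1] cP] := uniform_cap_ge d eps4.
apply: (squeeze_cvge (f := fun n => (1 - (size F)%:R * (1 - c) ^+ n)%:E) (h := cst 1%:E)).
- apply: nearW => n; rewrite probability_le1 ?andbT; last exact: measurable_chromatic.
  apply: (prob_chromatic_ge (X_unif n) (X_indep n) v_simplex eps_lt _ (noncol n)).
  by move=> i p /F1 p1; exact: (cP _ (X_unif n i)).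
- apply: cvg_EFin; first by apply: nearW => n.
  rewrite [X in X @ _](_ : _ = fun n => 1 - (size F)%:R * (1 - c) ^+ n) //.
  rewrite -[X in _ --> X]subr0 -[X in _ --> _ - X](mulr0 (size F)%:R).
  apply: cvgB; first exact: cvg_cst.
  apply: cvgM; first exact: cvg_cst.
  by apply: cvg_expr; rewrite ger0_norm; lra.
- exact: cvg_cst.
Qed.
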